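(* Let $t\in(0,1)$ be a rational number with continued fraction $t=[0,a_1,a_2,\dots,a_k]$, where $a_i\ge 1$ for all $i$ and $a_k\ge 2$. Then the 0-1 sequence of $t$ in the SC-tree is $$\overline{1\underbrace{0\cdots0}_{a_1-1}1\underbrace{0\cdots0}_{a_2-1}\cdots 1\underbrace{0\cdots0}_{a_{k-1}-1}1\underbrace{0\cdots0}_{a_k-2}}$$ (for $k=1$ this reads $\overline{1\underbrace{0\cdots0}_{a_1-2}}$).
   Context: Let $a,b$ be formal symbols. Consider the infinite binary tree $T$ (the ''S-tree with root $\frac ab$'') whose root is $\frac{a}{b}$ at level 0 and in which every vertex $\frac{u}{v}$ (including the root), where $u,v$ are formal integer linear forms in $a,b$, has left child $\frac{u}{u+v}$ and right child $\frac{v}{u+v}$ in the next level. The two children of a vertex of $T$ have the same denominator, of the form $ma+nb$. The SC-tree is obtained from $T$ by replacing, for each vertex $V$ of $T$, the two children of $V$, whose common denominator is $ma+nb$, by one single vertex $\frac{m}{n}$, placed in the same level as these children; the left (right) child of this SC-vertex is the SC-vertex obtained in the same way from the left (right) child of $V$. Thus level 1 consists of $\frac11$, level 2 of $\frac21,\frac12$ (from left to right), level 3 of $\frac31,\frac32,\frac13,\frac23$, and so on. In addition, two pseudo-fractions $\frac10$ and $\frac01$ are added at level 0, and $\frac11$ is declared to be the right child of $\frac10$ and the left child of $\frac01$. 0-1 sequences in the SC-tree: in level 2, the left vertex $\frac21$ has 0-1 sequence $\overline{0}$ and the right vertex $\frac12$ has 0-1 sequence $\overline{1}$; the 0-1 sequence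 of the left (right) child of a vertex is obtained by appending the digit $0$ (respectively $1$) on the right of the 0-1 sequence of that vertex. $[a_0,a_1,\dots,a_k]$ denotes the continued fraction $a_0+\cfrac{1}{a_1+\cfrac{1}{\ddots+\cfrac{1}{a_k}}}$ with $a_1,\dots,a_k$ positive integers. *)

(* Defs.v *)
From mathcomp Require Import all_boot all_order all_algebra.
Set Implicit Arguments.
Unset Strict Implicit.
Unset Printing Implicit Defensive.
Import Order.TTheory GRing.Theory Num.Theory.
Local Open Scope ring_scope.

(* The pair (m, n) stands for the formal integer linear form m a + n b; the
   Z-module structure is the componentwise one on int * int. *)
Definition linform : Type := (int * int)%type.

(* The formal fraction u / v is the pair (u, v). *)
Definition Tfrac : Type := (linform * linform)%type.

Definition Troot : Tfrac := ((1, 0), (0, 1)).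
Definition Tleft (x : Tfrac) : Tfrac := (x.1, x.1 + x.2).
Definition Tright (x : Tfrac) : Tfrac := (x.2, x.1 + x.2).

(* A vertex of the S-tree is given by its address, read from the root
   (false = left, true = right), so that distinct vertices stay distinct
   whatever their labels are. *)
Definition Tlabel (s : seq bool) : Tfrac :=
  foldl (fun x d => if d then Tright x else Tleft x) Troot s.

(* SCnode s is the vertex that replaces the two children of the vertex of the
   S-tree with address s; its level is (size s).+1.  SCinf and SCzero are the
   pseudo-fractions 1/0 and 0/1 of level 0. *)
Inductive SCvertex : Type :=
  | SCinf
  | SCzero
  | SCnode of seq bool.

(* The label m / n of an SC-vertex, as the pair (m, n).  For SCnode s it is the
   pair of coefficients of the denominator of the left child of s, which is also
   that of the right child by Tlabel_children_denom. *)
Definition SClabel (v : SCvertex) : int * int :=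
  match v with
  | SCinf => (1, 0)
  | SCzero => (0, 1)
  | SCnode s => (Tlabel (rcons s false)).2
  end.

Definition SCleft (v : SCvertex) : option SCvertex :=
  match v with
  | SCinf => None
  | SCzero => Some (SCnode [::])
  | SCnode s => Some (SCnode (rcons s false))
  end.

Definition SCright (v : SCvertex) : option SCvertex :=
  match v with
  | SCinf => Some (SCnode [::])
  | SCzero => None
  | SCnode s => Some (SCnode (rcons s true))
  end.

(* Digits are booleans: false is 0 and true is 1.  The relation only concerns
   vertices of level at least 2; the base cases are the two children of 1/1. *)
Inductive SCseq01 : SCvertex -> seq bool -> Prop :=
  | SCseq01_2l : SCseq01 (SCnode [:: false]) [:: false]
  | SCseq01_2r : SCseq01 (SCnode [:: true]) [:: true]
  | SCseq01_l v v' w :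
      SCseq01 v w -> SCleft v = Some v' -> SCseq01 v' (rcons w false)
  | SCseq01_r v v' w :
      SCseq01 v w -> SCright v = Some v' -> SCseq01 v' (rcons w true).

(* The condition on the denominator is needed because 1 / 0 = 0 in rat. *)
Definition SCrepresents (v : SCvertex) (t : rat) : Prop :=
  (SClabel v).2 != 0 /\ (SClabel v).1%:~R / (SClabel v).2%:~R = t.

Definition rat_seq01 (t : rat) (w : seq bool) : Prop :=
  exists2 v : SCvertex, SCrepresents v t & SCseq01 v w.

(* cfrac a0 [:: a1; ...; ak] is the continued fraction [a0, a1, ..., ak]. *)
Fixpoint cfrac (a0 : int) (s : seq nat) {struct s} : rat :=
  if s is a1 :: s' then a0%:~R + 1 / cfrac a1%:Z s' else a0%:~R.

Lemma Tlabel_children_denom (s : seq bool) :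
  (Tlabel (rcons s true)).2 = (Tlabel (rcons s false)).2.
Proof. by rewrite /Tlabel !foldl_rcons. Qed.

Example SClabel_levels123 :
  [seq SClabel (SCnode s) | s <-
    [:: [::]; [:: false]; [:: true]; [:: false; false]; [:: false; true];
        [:: true; false]; [:: true; true]]]
  = [:: (1, 1); (2, 1); (1, 2); (3, 1); (3, 2); (1, 3); (2, 3)].
Proof. by []. Qed.

(* Main.v *)
(** Prepending a digit to an address changes the label [x] of an SC-vertex into
    [1 + x] (digit 0) or [1 / (1 + x)] (digit 1), because the labels below a
    vertex [u / v] of the S-tree are fixed linear forms in [u] and [v].  The
    resulting value of a 0-1 word is greater than, less than or equal to 1
    according as the word starts with 0, starts with 1 or is empty, so it
    determines the word; and the block [1 0^(a - 1)] acts as [x |-> 1 / (a + x)],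
    which unfolds the continued fraction. *)
Require Import Defs.
From mathcomp Require Import all_boot all_order all_algebra.
Import Order.TTheory GRing.Theory Num.Theory.
Local Open Scope ring_scope.

Fixpoint word_value (s : seq bool) : rat :=
  if s is d :: s' then
    if d then (1 + word_value s')^-1 else 1 + word_value s'
  else 1.

Lemma word_value_gt0 s : 0 < word_value s.
Proof. by elim: s => [|[] s IHs] //=; rewrite ?invr_gt0 addr_gt0. Qed.

Lemma word_value_false_gt1 s : 1 < word_value (false :: s).
Proof. by rewrite /= ltrDl word_value_gt0. Qed.

Lemma word_value_true_lt1 s : word_value (true :: s) < 1.
Proof. by rewrite /= invf_lt1 ?ltrDl ?addr_gt0 // word_value_gt0. Qed.

Lemma word_value_inj : injective word_value.
Proof.
elim=> [|d s IHs] [|d' s'] // eq_ss'.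
- by case: d' eq_ss' (word_value_true_lt1 s') (word_value_false_gt1 s')
    => /= <- //; rewrite ltxx.
- by case: d eq_ss' (word_value_true_lt1 s) (word_value_false_gt1 s)
    => /= -> //; rewrite ltxx.
case: d d' eq_ss' => [] [] eq_ss'.
- by rewrite (IHs s') //; apply: (addrI 1); apply: invr_inj.
- have := lt_trans (word_value_true_lt1 s) (word_value_false_gt1 s').
  by rewrite eq_ss' ltxx.
- have := lt_trans (word_value_true_lt1 s') (word_value_false_gt1 s).
  by rewrite eq_ss' ltxx.
- by rewrite (IHs s') //; apply: (addrI 1).
Qed.

Lemma word_value_nseq_false n s :
  word_value (nseq n false ++ s) = n%:R + word_value s.
Proof. by elim: n => [|n IHn] /=; rewrite ?add0r // IHn addrA nat1r. Qed.

Lemma cfracE a0 s : cfrac a0 s = a0%:~R + cfrac 0 s.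
Proof. by case: s => [|a1 s] /=; rewrite ?addr0 ?add0r. Qed.

Lemma word_value_cfrac s l : all (leq 1) s -> (2 <= l)%N ->
  word_value (flatten [seq true :: nseq (a - 1) false | a <- s]
              ++ true :: nseq (l - 2) false) = cfrac 0 (rcons s l).
Proof.
move=> s_gt0 l_ge2; elim: s s_gt0 => [_|a s IHs /andP[a_gt0 /IHs {}IHs]] /=.
  (* The empty tail of the last block has value 1, not 0, so [l - 2] zeros give
     [1 / (1 + (l - 2) + 1) = 1 / l]. *)
  rewrite -[nseq _ _]cats0 word_value_nseq_false add0r div1r addrC -addrA.
  by rewrite -[1 + 1]/(2%:R) -natrD subnK.
rewrite -catA word_value_nseq_false IHs [cfrac a _]cfracE add0r div1r addrA.
by rewrite nat1r -addn1 subnK.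
Qed.

(** The sum [y.1 + y.2] is the denominator of both children of [y]. The start [x] is arbitrary
    because the first digit of the address moves it to a child, which turns [(p, q)] into
    [(p + q, q)] or [(q, p + q)]. *)
Lemma foldl_Tlabel_sum s : exists p q : int,
  [/\ 0 < p, 0 < q, p%:~R / q%:~R = word_value s
    & forall x : Tfrac,
      let y := foldl (fun x d => if d then Tright x else Tleft x) x s in
      y.1 + y.2 = x.1 *~ p + x.2 *~ q].
Proof.
elim: s => [|d s [p [q [p_gt0 q_gt0 valE IHs]]]]; first by exists 1, 1.
have q_neq0 : q%:~R != 0 :> rat by rewrite intr_eq0 gt_eqF.
have valD : 1 + word_value s = (p + q)%:~R / q%:~R.
  by rewrite -valE intrD mulrDl divff // addrC.
case: d; [exists q, (p + q) | exists (p + q), q]; split; rewrite ?addr_gt0 //=.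
- by rewrite valD invf_div.
- by move=> x; rewrite IHs /= mulrzDl mulrzDr addrCA.
- by move=> x; rewrite IHs /= mulrzDl mulrzDr addrA.
Qed.

Lemma SCrepresents_SCnode s t :
  SCrepresents (SCnode s) t <-> word_value s = t.
Proof.
have [p [q [_ q_gt0 <- sumE]]] := foldl_Tlabel_sum s.
have labelE : SClabel (SCnode s) = (p, q).
  (* The root consists of the basis forms [(1, 0)] and [(0, 1)], so [p] and [q] are the coefficients
     themselves. *)
  rewrite /SClabel /Tlabel foldl_rcons /= sumE.
  by rewrite [LHS]surjective_pairing !raddfD !raddfMz /= !mul0rz !intz addr0 add0r.
rewrite /SCrepresents labelE /= gt_eqF //.
by split=> [[]|].
Qed.

(** Address and 0-1 sequence grow by the same digit. Sequences start at level 2, so [1/1], with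
    empty address, has none. *)
Lemma SCseq01_SCnode v w : SCseq01 v w <-> v = SCnode w /\ w != [::].
Proof.
split=> [|[-> {v}]].
  elim=> // {}v v' {}w _ [-> _] [<-]; split=> //; by case: w.
elim/last_ind: w => // w d IHw _.
case: (eqVneq w [::]) => [->|/IHw w01]; first by case: d; constructor.
by case: d; [apply: SCseq01_r w01 _ | apply: SCseq01_l w01 _].
Qed.

Lemma rat_seq01P t w : rat_seq01 t w <-> word_value w = t /\ w != [::].
Proof.
split=> [[v vt /SCseq01_SCnode[vE w_neq0]]|[wt w_neq0]].
  by split=> //; apply/SCrepresents_SCnode; rewrite -vE.
by exists (SCnode w); [apply/SCrepresents_SCnode | apply/SCseq01_SCnode].
Qed.

Theorem theorem15 (t : rat) (k : nat) (a : nat -> nat)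
  (ht : 0 < t < 1)
  (hk : (1 <= k)%N)
  (ha : forall i : nat, (1 <= i <= k)%N -> (1 <= a i)%N)
  (hak : (2 <= a k)%N)
  (hcf : t = cfrac 0 [seq a i | i <- iota 1 k]) :
  forall w : seq bool,
    rat_seq01 t w <->
    w = flatten [seq true :: nseq (a i - 1) false | i <- iota 1 (k - 1)]
        ++ true :: nseq (a k - 2) false.
Proof.
move=> w; set w0 := _ ++ _.
have w0_neq0 : w0 != [::] by rewrite -size_eq0 size_cat addnS.
have iotaE : iota 1 k = rcons (iota 1 (k - 1)) k.
  by rewrite -[in LHS](subnK hk) iotaD subnKC // cats1.
have w0t : word_value w0 = t.
  rewrite hcf iotaE map_rcons -word_value_cfrac // -?map_comp //.
  rewrite all_map; apply/allP => i; rewrite mem_iota => /andP[i_gt0 i_lt].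
  by apply: ha; rewrite i_gt0 ltnW // -(subnKC hk).
split=> [/rat_seq01P[wt _]|->]; last by apply/rat_seq01P.
(* Uniqueness: [w] and [w0] both have value [t]. *)
by apply: word_value_inj; rewrite wt.
Qed.
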